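(* Let $\mathfrak R$ and $\mathfrak S$ be complete, separated right linear topological rings with countable bases of neighborhoods of zero, and let $\mathfrak f\colon\mathfrak R\to\mathfrak S$ be a taut continuous ring map. Assume that the forgetful functor $\mathfrak R\text{-}\mathsf{Contra}\to\mathfrak R\text{-}\mathsf{Mod}$ is fully faithful. Then a right $\mathfrak S$-module is discrete if and only if its underlying right $\mathfrak R$-module is discrete.
   Context: All rings are associative and unital, and ring maps are unital ring homomorphisms. A topological ring is right linear if open right ideals form a base of neighborhoods of zero; it is complete and separated if the natural map to the projective limit of its quotients by all open subgroups is bijective. A ring map $\mathfrak f\colon\mathfrak R\to\mathfrak S$ of right linear topological rings is taut if for every open right ideal $\mathfrak I\subset\mathfrak R$ the closure of the right ideal $\mathfrak f(\mathfrak I)\mathfrak S\subset\mathfrak S$ generated by $\mathfrak f(\mathfrak I)$ is open in $\mathfrak S$. A right module over a right linear topological ring is discrete if the annihilator of each of its elements is an open right ideal. Contramodules. For a set $X$, let $\mathfrak R[[X]]$ be the set of all infinite formal linear combinations $\sum_{x\in X}r_xx$ whose coefficient families $(r_x\in\mathfrak R)_{x\in X}$ converge to zero (for every open subgroup $\mathfrak U\subset\mathfrak R$, $r_x\in\mathfrak U$ for all but finitely many $x$). A map $g\colon X\to Y$ induces $\mathfrak R[[g]]\colon\sum_x r_xx\mapsto\sum_y\bigl(\sum_{g(x)=y}r_x\bigr)y$, where infinite sums in $\mathfrak R$ are limits of finite partial sums. The functor $\mathfrak R[[-]]$ is a monad on sets with unit $\epsilon_X\colon x\mapsto 1\cdot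 x$ and multiplication $\phi_X\colon\mathfrak R[[\mathfrak R[[X]]]]\to\mathfrak R[[X]]$ given by opening parentheses. A left $\mathfrak R$-contramodule is a module (algebra) over this monad, i.e. a set $\mathfrak P$ with a map $\pi_{\mathfrak P}\colon\mathfrak R[[\mathfrak P]]\to\mathfrak P$ satisfying $\pi_{\mathfrak P}\epsilon_{\mathfrak P}=\mathrm{id}$ and $\pi_{\mathfrak P}\circ\mathfrak R[[\pi_{\mathfrak P}]]=\pi_{\mathfrak P}\circ\phi_{\mathfrak P}$. These form an abelian category $\mathfrak R\text{-}\mathsf{Contra}$. Restricting $\pi_{\mathfrak P}$ to the subset $\mathfrak R[\mathfrak P]\subset\mathfrak R[[\mathfrak P]]$ of finite linear combinations gives a left $\mathfrak R$-module structure on $\mathfrak P$; this is the forgetful functor $\mathfrak R\text{-}\mathsf{Contra}\to\mathfrak R\text{-}\mathsf{Mod}$ to the category of left $\mathfrak R$-modules. *)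

(* Defs.v *)
From HB Require Import structures.
From mathcomp Require Import all_boot all_order all_algebra finmap.
From mathcomp Require Import boolp classical_sets functions cardinality.
From mathcomp Require Import filter topology tvs.
From mathcomp Require showcase.summability.

Set Implicit Arguments.
Unset Strict Implicit.
Unset Printing Implicit Defensive.

Import GRing.Theory.

Local Open Scope classical_set_scope.
Local Open Scope ring_scope.

(* [totally] is the filter of finite subsets of [I] directed by inclusion, and
   [partial_sum r J] is the sum of [r x] over [x] in the finite set [J]. *)
Notation totally := showcase.summability.totally.
Notation partial_sum := showcase.summability.partial_sum.
Existing Instance showcase.summability.totally_filter.

(* The zero ring is allowed, hence [PzRing]. *)
HB.mixin Record TopologicalZmodule_isTopologicalRing R
    & TopologicalZmodule R & GRing.PzRing R := {
  mul_continuous : continuous (fun x : R * R => x.1 * x.2)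
}.

#[short(type="topRingType")]
HB.structure Definition TopologicalRing :=
  {R of TopologicalZmodule R & GRing.PzRing R
      & TopologicalZmodule_isTopologicalRing R}.

Definition subgroup (R : topRingType) (U : set R) : Prop :=
  U 0 /\ (forall x y, U x -> U y -> U (x - y)).

Definition open_subgroup (R : topRingType) (U : set R) : Prop :=
  open U /\ subgroup U.

Definition right_ideal (R : topRingType) (I : set R) : Prop :=
  subgroup I /\ (forall x r, I x -> I (x * r)).

Definition open_right_ideal (R : topRingType) (I : set R) : Prop :=
  open I /\ right_ideal I.

Definition right_linear (R : topRingType) : Prop :=
  forall V : set R, nbhs 0 V -> exists2 I, open_right_ideal I & I `<=` V.

Definition countable_base_at_zero (R : topRingType) : Prop :=
  exists2 B : set (set R), countable B & nbhs (0 : R) = filter_from B id.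

Definition coset (R : topRingType) (U : set R) (r : R) : set R :=
  [set x | U (x - r)].

(* The projective limit of the quotient groups R/U over all open subgroups U;
   the elements of R/U are represented as subsets of R. *)
Record quotient_limit (R : topRingType) := QuotientLimit {
  component : forall U : set R, open_subgroup U -> set R;
  component_coset : forall U (oU : open_subgroup U),
    exists r, component oU = coset U r;
  component_compat : forall U V (oU : open_subgroup U) (oV : open_subgroup V),
    U `<=` V -> component oU `<=` component oV
}.

Lemma quotient_limitP (R : topRingType) (c d : quotient_limit R) :
  (forall U (oU : open_subgroup U), component c oU = component d oU) -> c = d.
Proof.
case: c d => [c c1 c2] [d d1 d2] /= cd.
have {cd} E : c = d by apply: functional_extensionality_dep => U; exact/funext.
by case: d / E d1 d2 => d1 d2; congr QuotientLimit; exact: Prop_irrelevance.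
Qed.

Lemma coset_exists (R : topRingType) (r : R) (U : set R) (oU : open_subgroup U) :
  exists s, coset U r = coset U s.
Proof. by exists r. Qed.

Lemma coset_compat (R : topRingType) (r : R) (U V : set R)
  (oU : open_subgroup U) (oV : open_subgroup V) :
  U `<=` V -> coset U r `<=` coset V r.
Proof. by move=> UV x; exact: UV. Qed.

Definition to_quotient_limit (R : topRingType) (r : R) : quotient_limit R :=
  QuotientLimit (@coset_exists R r) (@coset_compat R r).

Definition complete_separated (R : topRingType) : Prop :=
  bijective (@to_quotient_limit R).

HB.mixin Record TopologicalRing_isCompleteRightLinear R
    & TopologicalRing R := {
  right_linearP : right_linear R;
  complete_separatedP : complete_separated R
}.

#[short(type="crlRingType")]
HB.structure Definition CompleteRightLinearRing :=
  {R of TopologicalRing R & TopologicalRing_isCompleteRightLinear R}.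

Definition taut (R S : topRingType) (f : R -> S) : Prop :=
  forall I : set R, open_right_ideal I ->
    open (closure (smallest (@right_ideal S) (f @` I))).

(* Right R-modules are left modules over the opposite ring [R^c]. *)
Definition discrete_right_module (R : topRingType) (N : lmodType R^c) : Prop :=
  forall n : N, open_right_ideal [set r : R | (r : R^c) *: n = 0].

Definition restrict_scalars (R S : topRingType) (f : {rmorphism R -> S})
  (N : lmodType S^c) : Type := N.

Section RestrictScalars.
Variables (R S : topRingType) (f : {rmorphism R -> S}) (N : lmodType S^c).

HB.instance Definition _ := GRing.Zmodule.on (restrict_scalars f N).

Definition restrict_scale (r : R^c) (n : restrict_scalars f N) :
  restrict_scalars f N := (f r : S^c) *: (n : N).

Fact restrict_scaleA a b n :
  restrict_scale a (restrict_scale b n) = restrict_scale (a * b) n.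
Proof.
rewrite /restrict_scale scalerA; congr (_ *: _).
exact: (esym (rmorphM f b a)).
Qed.

Fact restrict_scale1 : left_id 1 restrict_scale.
Proof.
move=> n; rewrite /restrict_scale.
have -> : f (1 : R^c) = (1 : S^c) by exact: (rmorph1 f).
exact: scale1r.
Qed.

Fact restrict_scaleDr : right_distributive restrict_scale +%R.
Proof. by move=> a x y; exact: scalerDr. Qed.

Fact restrict_scaleDl n : {morph restrict_scale^~ n : a b / a + b}.
Proof.
move=> a b; rewrite /restrict_scale.
have -> : f (a + b : R^c) = (f a : S^c) + f b by exact: (rmorphD f).
exact: scalerDl.
Qed.

HB.instance Definition _ := GRing.Zmodule_isLmodule.Build R^c
  (restrict_scalars f N)
  restrict_scaleA restrict_scale1 restrict_scaleDr restrict_scaleDl.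
End RestrictScalars.

Definition converges_to_zero (R : topRingType) (X : Type) (r : X -> R) : Prop :=
  forall U : set R, open_subgroup U -> finite_set [set x | ~ U (r x)].

Definition tsum (R : topRingType) (X : choiceType) (r : X -> R) : R :=
  xget 0 [set s : R | partial_sum r @ totally --> s].

Section Sums.
Variable R : crlRingType.

Lemma subgroupN (U : set R) x : subgroup U -> U x -> U (- x).
Proof. by move=> [U0 UB] Ux; rewrite -sub0r; exact: UB. Qed.

Lemma subgroupD (U : set R) x y : subgroup U -> U x -> U y -> U (x + y).
Proof.
move=> sU Ux Uy; rewrite -[y]opprK; apply: sU.2 => //; exact: subgroupN.
Qed.

Lemma subgroup_sum (U : set R) (I : Type) (s : seq I) (P : pred I) (F : I -> R) :
  subgroup U -> (forall i, P i -> U (F i)) -> U (\sum_(i <- s | P i) F i).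
Proof.
move=> sU UF; elim/big_ind : _ => //; first exact: sU.1.
by move=> x y; exact: subgroupD.
Qed.

Lemma partial_sumE (X : choiceType) (r : X -> R) (J : {fset X}) :
  partial_sum r J = \sum_(x <- J) r x.
Proof. by rewrite /showcase.summability.partial_sum big_seq_fsetE. Qed.

Lemma partial_sumB (X : choiceType) (r : X -> R) (U : set R) (J K : {fset X}) :
  subgroup U -> (forall x, x \notin J -> U (r x)) -> (J `<=` K)%fset ->
  U (partial_sum r K - partial_sum r J).
Proof.
move=> sU UJ JK; rewrite !partial_sumE (big_fsetID _ (mem J)) /=.
rewrite (_ : [fset x in K | x \in J]%fset = J); last first.
  apply/fsetP => x; rewrite !inE /= andbC; case: (boolP (x \in J)) => //= xJ.
  by rewrite (fsubsetP JK).
rewrite addrAC subrr add0r big_seq; apply: subgroup_sum => // x.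
by rewrite !inE /= => /andP[_ /UJ].
Qed.

Lemma nbhs_open_subgroup (U : set R) (s : R) :
  open_subgroup U -> nbhs s (coset U s).
Proof.
move=> [oU sU].
have /= : (fun x : R => x - s) @ s --> s - s.
  apply: (@continuous_comp _ _ _ (fun x : R => (x, s)) (fun x => x.1 - x.2)).
    by apply: cvg_pair => /=; [exact: cvg_id | exact: cvg_cst].
  exact: sub_continuous.
rewrite subrr => /(_ U) /=; apply; apply: open_nbhs_nbhs; split => //; exact: sU.1.
Qed.

Lemma nbhs_coset (V : set R) (s : R) : nbhs s V ->
  exists2 U, open_subgroup U & coset U s `<=` V.
Proof.
move=> sV.
have /= cvs : (fun x : R => s + x) @ 0 --> s + 0.
  apply: (@continuous_comp _ _ _ (fun x : R => (s, x)) (fun x => x.1 + x.2)).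
    by apply: cvg_pair => /=; [exact: cvg_cst | exact: cvg_id].
  exact: add_continuous.
rewrite addr0 in cvs.
have /right_linearP [I [oI [sI _]] IV] := cvs _ sV.
exists I => // x /IV /=; by rewrite addrC subrK.
Qed.

Lemma separatedP (s t : R) :
  (forall U, open_subgroup U -> U (s - t)) -> s = t.
Proof.
move=> st; apply: (bij_inj (@complete_separatedP R)).
have E : forall U, open_subgroup U -> coset U s = coset U t.
  move=> U oU; have sU := oU.2; apply/seteqP; split => x /= Ux.
    by rewrite /coset /= -(subrKA s); apply: subgroupD sU Ux (st U oU).
  have ts : U (t - s) by rewrite -opprB; apply: subgroupN sU (st U oU).
  by rewrite /coset /= -(subrKA t); apply: subgroupD sU Ux ts.
by apply: quotient_limitP => U oU; exact: E.
Qed.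

Definition is_tsum (X : choiceType) (r : X -> R) (s : R) : Prop :=
  forall U, open_subgroup U -> \forall J \near totally, U (partial_sum r J - s).

Lemma is_tsumP (X : choiceType) (r : X -> R) (s : R) :
  is_tsum r s <-> partial_sum r @ totally --> s.
Proof.
split=> [rs V /nbhs_coset [U oU UV]|rs U oU].
  have := rs _ oU; apply: filterS => J; exact: UV.
exact: (rs _ (nbhs_open_subgroup s oU)).
Qed.

Lemma is_tsum_unique (X : choiceType) (r : X -> R) (s t : R) :
  is_tsum r s -> is_tsum r t -> s = t.
Proof.
move=> rs rt; apply: separatedP => U oU.
have [J [Js Jt]] := filter_ex (filterI (rs U oU) (rt U oU)).
rewrite -(subrKA (partial_sum r J)); apply: subgroupD => //; first exact: oU.2.
by rewrite -opprB; apply: subgroupN => //; exact: oU.2.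
Qed.

Lemma tsum_eq (X : choiceType) (r : X -> R) (s : R) : is_tsum r s -> tsum r = s.
Proof.
move=> rs; rewrite /tsum; case: xgetP => [t _ /is_tsumP rt|/(_ s)].
  exact: is_tsum_unique rt rs.
by move/is_tsumP: rs.
Qed.

Lemma ex_tsum (X : choiceType) (r : X -> R) :
  converges_to_zero r -> exists s, is_tsum r s.
Proof.
move=> r0.
pose F U (oU : open_subgroup U) : {fset X} := fset_set [set x | ~ U (r x)].
have FP U (oU : open_subgroup U) x : x \notin F U oU -> U (r x).
  rewrite in_fset_set; last exact: r0.
  by move=> /negP xF; apply: contrapT => Ux; apply: xF; rewrite inE.
pose c U oU := coset U (partial_sum r (F U oU)).
have c1 : forall U (oU : open_subgroup U), exists t, c U oU = coset U t.
  by move=> U oU; exists (partial_sum r (F U oU)).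
have c2 : forall U V (oU : open_subgroup U) (oV : open_subgroup V),
    U `<=` V -> c U oU `<=` c V oV.
  move=> U V oU oV UV x; rewrite /c /coset /= => /UV Vx.
  rewrite -(subrKA (partial_sum r (F U oU))); apply: subgroupD => //.
    exact: oV.2.
  apply: partial_sumB; [exact: oV.2|exact: FP|].
  apply/fsubsetP => y; rewrite !in_fset_set; try exact: r0.
  by rewrite !inE; apply: contra_not => /UV.
have [g _ gK] := @complete_separatedP R.
exists (g (QuotientLimit c1 c2)) => U oU.
set s := g _.
have : component (to_quotient_limit s) oU = c U oU by rewrite gK.
move=> /= /(congr1 (fun A : set R => A s)); rewrite /c /coset /= subrr => Es.
have Us : U (s - partial_sum r (F U oU)) by rewrite -Es; exact: oU.2.1.
exists (F U oU) => // J /= FJ.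
rewrite -(subrKA (partial_sum r (F U oU))); apply: subgroupD; first exact: oU.2.
  by apply: partial_sumB => //; [exact: oU.2|exact: FP].
by rewrite -opprB; apply: subgroupN => //; exact: oU.2.
Qed.

Lemma tsum_is (X : choiceType) (r : X -> R) :
  converges_to_zero r -> is_tsum r (tsum r).
Proof. by move=> /ex_tsum [s rs]; rewrite (tsum_eq rs). Qed.

Lemma tsum_subgroup (X : choiceType) (r : X -> R) (U : set R) :
  converges_to_zero r -> open_subgroup U -> (forall x, U (r x)) -> U (tsum r).
Proof.
move=> r0 oU Ur; have [J UJ] := filter_ex (tsum_is r0 oU).
rewrite -[tsum r](subKr (partial_sum r J)); apply: oU.2.2 => //.
by rewrite partial_sumE; apply: subgroup_sum => //; exact: oU.2.
Qed.

Lemma tsum_fin (X : choiceType) (r : X -> R) (J : {fset X}) :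
  (forall x, x \notin J -> r x = 0) -> tsum r = \sum_(x <- J) r x.
Proof.
move=> rJ; apply: tsum_eq => U oU; exists J => // K /= JK.
rewrite -partial_sumE; apply: partial_sumB => //; first exact: oU.2.
by move=> x /rJ ->; exact: oU.2.1.
Qed.

Lemma tsum_delta (X : choiceType) (I : Type) (s : seq I) (h : I -> X)
    (G : I -> X -> R) :
  tsum (fun x => \sum_(i <- s) (if h i == x then G i x else 0)) =
  \sum_(i <- s) G i (h i).
Proof.
rewrite (@tsum_fin _ _ [fset x in map h s]%fset); last first.
  move=> x; rewrite inE /=.
  elim: s => [|i s IH] /=; first by rewrite big_nil.
  rewrite inE negb_or => /andP[xi /IH].
  by rewrite big_cons eq_sym (negbTE xi) add0r.
rewrite exchange_big /=.
have : forall J : {fset X}, {subset map h s <= J} ->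
    \sum_(i <- s) \sum_(x <- J) (if h i == x then G i x else 0) =
    \sum_(i <- s) G i (h i).
  move=> J; elim: s => [|i s IH] sJ; first by rewrite !big_nil.
  rewrite !big_cons IH; last by move=> x xs; apply: sJ; rewrite inE xs orbT.
  congr (_ + _); rewrite (big_fsetD1 (h i)) /=; last first.
    by apply: sJ; rewrite inE eqxx.
  rewrite eqxx big1_seq ?addr0 // => x /andP[_].
  by rewrite !inE eq_sym => /andP[/negbTE ->].
by apply => x xs; rewrite inE.
Qed.

Lemma cvg0_if (X : Type) (r : X -> R) (P : pred X) :
  converges_to_zero r -> converges_to_zero (fun x => if P x then r x else 0).
Proof.
move=> r0 U oU; apply: sub_finite_set (r0 U oU) => x /=.
by case: (P x) => // /(_ oU.2.1).
Qed.

Lemma cvg0_mulr (X : Type) (r a : X -> R) :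
  converges_to_zero r -> converges_to_zero (fun x => r x * a x).
Proof.
move=> r0 U oU.
have /right_linearP [I [oI [sI Ir]] IU] : nbhs 0 U.
  by apply: open_nbhs_nbhs; split; [exact: oU.1|exact: oU.2.1].
apply: sub_finite_set (r0 I (conj oI sI)) => x /=.
by apply: contra_not => /(Ir _ (a x)) /IU.
Qed.

Lemma open_subgroup_mull (U : set R) (a : R) : open_subgroup U ->
  exists2 V, open_subgroup V & forall x, V x -> U (a * x).
Proof.
move=> oU.
have /= cva : (fun x : R => a * x) @ 0 --> a * 0.
  apply: (@continuous_comp _ _ _ (fun x : R => (a, x)) (fun x => x.1 * x.2)).
    by apply: cvg_pair => /=; [exact: cvg_cst | exact: cvg_id].
  exact: mul_continuous.
rewrite mulr0 in cva.
have /right_linearP [I [oI [sI _]] IU] : nbhs 0 [set x | U (a * x)].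
  by apply: cva; apply: open_nbhs_nbhs; split; [exact: oU.1|exact: oU.2.1].
by exists I.
Qed.

End Sums.

(* [combs R X] is the set R[[X]] of infinite formal linear combinations; with
   [combs_unit], [combs_map] and [combs_mul] it is the monad R[[-]]. *)
Record combs (R : topRingType) (X : choiceType) := Combs {
  coef :> X -> R;
  coef_cvg0 : converges_to_zero coef
}.

HB.instance Definition _ (R : topRingType) (X : choiceType) :=
  gen_eqMixin (combs R X).
HB.instance Definition _ (R : topRingType) (X : choiceType) :=
  gen_choiceMixin (combs R X).

Lemma combsP (R : topRingType) (X : choiceType) (r s : combs R X) :
  r =1 s -> r = s.
Proof.
case: r s => [r r0] [s s0] /= /funext rs; move: s0; rewrite -rs => s0.
congr Combs; exact: Prop_irrelevance.
Qed.

Section Monad.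
Variable R : crlRingType.

Lemma combs_unit_cvg0 (X : choiceType) (x : X) :
  converges_to_zero (fun y => if x == y then 1 else 0 : R).
Proof.
move=> U oU; apply: sub_finite_set (finite_set1 x) => y /=.
by case: eqP => // _ /(_ oU.2.1).
Qed.

Definition combs_unit (X : choiceType) (x : X) : combs R X :=
  Combs (combs_unit_cvg0 x).

Lemma combs_map_cvg0 (X Y : choiceType) (g : X -> Y) (r : combs R X) :
  converges_to_zero (fun y => tsum (fun x => if g x == y then r x else 0)).
Proof.
move=> U oU.
apply: sub_finite_set (finite_image g (coef_cvg0 r oU)) => y /= NU.
apply: contrapT => Ny; apply: NU; apply: tsum_subgroup => //.
  exact: (cvg0_if (fun x => g x == y) (coef_cvg0 r)).
move=> x; case: eqP => [gxy|_]; last exact: oU.2.1.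
by apply: contrapT => Ur; apply: Ny; exists x.
Qed.

Definition combs_map (X Y : choiceType) (g : X -> Y) (r : combs R X) :
  combs R Y := Combs (combs_map_cvg0 g r).

Lemma combs_mul_cvg0 (X : choiceType) (r : combs R (combs R X)) :
  converges_to_zero (fun x => tsum (fun s : combs R X => r s * s x)).
Proof.
move=> U oU.
have /right_linearP [I [oI [sI Ir]] IU] : nbhs 0 U.
  by apply: open_nbhs_nbhs; split; [exact: oU.1|exact: oU.2.1].
have osI : open_subgroup I by split.
have fI := coef_cvg0 r osI.
pose B := [set s | ~ I (r s)].
have : finite_set (\bigcup_(s in B) [set x | ~ I (r s * s x)]).
  apply: bigcup_finite => // s _.
  have [V oV VI] := open_subgroup_mull (r s) osI.
  by apply: sub_finite_set (coef_cvg0 s oV) => x /=; apply: contra_not => /VI.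
apply: sub_finite_set => x /= NU; apply: contrapT => Nx; apply: NU.
apply/IU; apply: tsum_subgroup => //.
  exact: (cvg0_mulr (fun s : combs R X => s x) (coef_cvg0 r)).
move=> s; apply: contrapT => NI; apply: Nx; exists s => //.
by rewrite /B /=; apply: contra_not NI; exact: Ir.
Qed.

Definition combs_mul (X : choiceType) (r : combs R (combs R X)) : combs R X :=
  Combs (combs_mul_cvg0 r).

Lemma lincomb_cvg0 (X : choiceType) (s : seq (R * X)) :
  converges_to_zero (fun x => \sum_(i <- s) (if i.2 == x then i.1 else 0)).
Proof.
move=> U oU; apply: sub_finite_set (finite_seq (map snd s)) => x /=.
apply: contra_notP; elim: s => [|i s IH] xs; first by rewrite big_nil; exact: oU.2.1.
move: xs => /= /negP; rewrite inE negb_or => /andP[xi /negP/IH Us].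
by rewrite big_cons eq_sym (negbTE xi) add0r.
Qed.

Definition lincomb (X : choiceType) (s : seq (R * X)) : combs R X :=
  Combs (lincomb_cvg0 s).

Lemma combs_unitE (X : choiceType) (x : X) :
  combs_unit x = lincomb [:: (1, x)].
Proof. by apply: combsP => y /=; rewrite big_seq1. Qed.

Lemma combs_map_lincomb (X Y : choiceType) (g : X -> Y) (s : seq (R * X)) :
  combs_map g (lincomb s) = lincomb [seq (i.1, g i.2) | i <- s].
Proof.
apply: combsP => y /=; rewrite big_map /=.
rewrite -(tsum_delta s snd (fun i x => if g x == y then i.1 else 0)).
congr tsum; apply/funext => x; case: ifP => // _.
by rewrite big1 // => i _; case: ifP.
Qed.

Lemma combs_mul_lincomb (X : choiceType) (s : seq (R * seq (R * X))) :
  combs_mul (lincomb [seq (i.1, lincomb i.2) | i <- s]) =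
  lincomb (flatten [seq [seq (i.1 * j.1, j.2) | j <- i.2] | i <- s]).
Proof.
apply: combsP => x /=.
transitivity (\sum_(i <- s) i.1 * lincomb i.2 x).
  rewrite -(tsum_delta s (fun i => lincomb i.2) (fun i t => i.1 * t x)).
  congr tsum; apply/funext => t; rewrite big_map mulr_suml.
  by apply: eq_bigr => i _ /=; case: ifP => // _; rewrite mul0r.
rewrite big_flatten big_map; apply: eq_bigr => i _; rewrite /= big_map mulr_sumr.
by apply: eq_bigr => j _ /=; case: ifP => // _; rewrite mulr0.
Qed.

Lemma lincomb_eq (X : choiceType) (s t : seq (R * X)) :
  (forall x, \sum_(i <- s) (if i.2 == x then i.1 else 0) =
             \sum_(i <- t) (if i.2 == x then i.1 else 0)) ->
  lincomb s = lincomb t.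
Proof. by move=> st; apply: combsP. Qed.

End Monad.

HB.mixin Record isContramodule (R : crlRingType) P & Choice P := {
  contra_act : combs R P -> P;
  contra_act_unit : forall p : P, contra_act (combs_unit R p) = p;
  contra_act_mul : forall r : combs R (combs R P),
    contra_act (combs_map contra_act r) = contra_act (combs_mul r)
}.

#[short(type="contramodType")]
HB.structure Definition Contramodule (R : crlRingType) :=
  {P of Choice P & isContramodule R P}.

Record contra_hom (R : crlRingType) (P Q : contramodType R) := ContraHom {
  contra_fun :> P -> Q;
  contra_funP : forall r : combs R P,
    contra_fun (contra_act r) = contra_act (combs_map contra_fun r)
}.

(* The underlying left R-module: the alias carries the operations given by
   the action of the finite linear combinations [lincomb]. *)
Definition contra_forget (R : crlRingType) (P : contramodType R) : Type := P.

Section ForgetObject.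
Variables (R : crlRingType) (P : contramodType R).
Local Notation U := (contra_forget P).
Implicit Types (x y z : U) (a b : R).

HB.instance Definition _ := Choice.on U.

Definition contra_lin (s : seq (R * P)) : U := contra_act (lincomb s).

Definition contra_zero : U := contra_lin [::].
Definition contra_add x y : U := contra_lin [:: (1, x); (1, y)].
Definition contra_opp x : U := contra_lin [:: (-1, x)].
Definition contra_scale a x : U := contra_lin [:: (a, x)].

Lemma contra_lin1 x : contra_lin [:: (1, x)] = x.
Proof. by rewrite /contra_lin -combs_unitE contra_act_unit. Qed.

Lemma contra_linA (s : seq (R * seq (R * P))) :
  contra_lin [seq (i.1, contra_lin i.2) | i <- s] =
  contra_lin (flatten [seq [seq (i.1 * j.1, j.2) | j <- i.2] | i <- s]).
Proof.
rewrite /contra_lin -combs_mul_lincomb -contra_act_mul combs_map_lincomb.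
by rewrite -map_comp.
Qed.

Lemma contra_lin_eq (s t : seq (R * P)) :
  (forall x : P, \sum_(i <- s) (if i.2 == x then i.1 else 0) =
             \sum_(i <- t) (if i.2 == x then i.1 else 0)) ->
  contra_lin s = contra_lin t.
Proof. by move=> st; rewrite /contra_lin (lincomb_eq st). Qed.

Fact contra_addC : commutative contra_add.
Proof.
by move=> x y; apply: contra_lin_eq => z; rewrite !big_cons !big_nil !addr0 addrC.
Qed.

Fact contra_addA : associative contra_add.
Proof.
move=> x y z; rewrite /contra_add -{1}(contra_lin1 x) -{2}(contra_lin1 z).
have := contra_linA [:: (1, [:: (1, x)]); (1, [:: (1, y); (1, z)])].
have := contra_linA [:: (1, [:: (1, x); (1, y)]); (1, [:: (1, z)])].
by rewrite /= !mul1r => -> ->.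
Qed.

Fact contra_add0 : left_id contra_zero contra_add.
Proof.
move=> x; rewrite /contra_add -{1}(contra_lin1 x).
have := contra_linA [:: (1, [::]); (1, [:: (1, x)])].
by rewrite /= !mul1r contra_lin1.
Qed.

Fact contra_addN : left_inverse contra_zero contra_opp contra_add.
Proof.
move=> x; rewrite /contra_add -{2}(contra_lin1 x).
have := contra_linA [:: (1, [:: (-1, x)]); (1, [:: (1, x)])].
rewrite /= !mul1r => ->; apply: contra_lin_eq => z.
by rewrite !big_cons !big_nil /=; case: ifP; rewrite !addr0 // addNr.
Qed.

HB.instance Definition _ := GRing.isZmodule.Build U
  contra_addA contra_addC contra_add0 contra_addN.

Fact contra_scaleA a b x :
  contra_scale a (contra_scale b x) = contra_scale (a * b) x.
Proof. by have := contra_linA [:: (a, [:: (b, x)])]. Qed.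

Fact contra_scale1 : left_id 1 contra_scale.
Proof. exact: contra_lin1. Qed.

Fact contra_scaleDr : right_distributive contra_scale +%R.
Proof.
move=> a x y.
have := contra_linA [:: (a, [:: (1, x); (1, y)])].
have := contra_linA [:: (1, [:: (a, x)]); (1, [:: (a, y)])].
by rewrite /= !mul1r !mulr1 => <-.
Qed.

Fact contra_scaleDl x : {morph contra_scale^~ x : a b / a + b}.
Proof.
move=> a b.
have := contra_linA [:: (1, [:: (a, x)]); (1, [:: (b, x)])].
rewrite /= !mul1r => H.
rewrite [RHS]H; apply: contra_lin_eq => z.
by rewrite !big_cons !big_nil /=; case: ifP; rewrite !addr0.
Qed.

HB.instance Definition _ := GRing.Zmodule_isLmodule.Build R U
  contra_scaleA contra_scale1 contra_scaleDr contra_scaleDl.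
End ForgetObject.

Section ForgetMorphism.
Variables (R : crlRingType) (P Q : contramodType R) (h : contra_hom P Q).

Definition contra_forget_fun : contra_forget P -> contra_forget Q := h.

Lemma contra_hom_lin (s : seq (R * P)) :
  h (contra_lin s) = contra_lin [seq (i.1, h i.2) | i <- s].
Proof. by rewrite /contra_lin contra_funP combs_map_lincomb. Qed.

Fact contra_forget_zmod : zmod_morphism contra_forget_fun.
Proof.
move=> x y.
have D u v : contra_forget_fun (u + v) = contra_forget_fun u + contra_forget_fun v.
  exact: contra_hom_lin.
by apply/eqP; rewrite eq_sym subr_eq -D subrK.
Qed.

Fact contra_forget_scalable : scalable contra_forget_fun.
Proof. by move=> a x; exact: contra_hom_lin. Qed.

HB.instance Definition _ := GRing.isZmodMorphism.Build
  (contra_forget P) (contra_forget Q) contra_forget_fun contra_forget_zmod.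
HB.instance Definition _ := GRing.isScalable.Build R
  (contra_forget P) (contra_forget Q) *:%R contra_forget_fun
  contra_forget_scalable.

Definition contra_forget_hom : {linear contra_forget P -> contra_forget Q} :=
  contra_forget_fun.
End ForgetMorphism.

Definition contra_forget_fully_faithful (R : crlRingType) : Prop :=
  forall P Q : contramodType R, bijective (@contra_forget_hom R P Q).

(* Main.v *)
Require Import Defs.
From HB Require Import structures.
From mathcomp Require Import all_boot all_algebra finmap ring_quotient.
From mathcomp Require Import boolp classical_sets cardinality fsbigop.
From mathcomp Require Import filter topology tvs.

(* If [n] in [N] is annihilated by the open right ideal [I] of [R], it is
   annihilated by the right ideal [f(I) S], and by tautness it suffices that
   [f(I) S] contains the closure of [f(J) S] for some open right ideal [J].
   An element of this closure is the sum of a series of terms [f(a_x) t_x] with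
   [a_x] converging to zero in [R].  Full faithfulness yields
   [R[[X]] = R[X] + I R[[X]]], since the map [p |-> (a |-> a p)] from [R[[X]]]
   to the contramodule [Hom(R / I, R[[X]] / (R[X] + I R[[X]]))] is [R]-linear
   and vanishes on [X].  Hence, up to finitely many [x], [a_x] is a finite sum
   of [s_j r_(j,x)] with [s_j] in [I] and [r_(j,x)] converging to zero in [x],
   and the series collapses to a finite combination of elements of [f(I)]. *)

Import GRing.Theory.
Set Implicit Arguments.
Unset Strict Implicit.
Unset Printing Implicit Defensive.
Local Open Scope classical_set_scope.
Local Open Scope ring_scope.

(** * Quotients of abelian groups by subgroups *)

Section SubgroupQuotient.
Local Open Scope quotient_scope.
Variables (A : zmodType) (V : set A).
Hypotheses (V0 : V 0) (VB : forall x y, V x -> V y -> V (x - y)).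

Let mem_V of V 0 & (forall x y, V x -> V y -> V (x - y)) : {pred A} :=
  fun x => `[< V x >].
Let inV := mem_V V0 VB.

Let inV_zmod_closed : zmod_closed inV.
Proof.
split=> [|x y]; rewrite !unfold_in; first exact/asboolP.
by move=> /asboolP Vx /asboolP Vy; exact/asboolP/VB.
Qed.

HB.instance Definition _ := GRing.isZmodClosed.Build A inV inV_zmod_closed.

(** Used with [V] an open right ideal of [R], and later with [V] the subgroup R[X] + I R[[X]] of
    R[[X]]. *)
Lemma exists_quotient : exists (E : zmodType) (q : {additive A -> E}),
  forall x, q x = 0 <-> V x.
Proof.
exists (Quotient.quot inV), \pi_(Quotient.quot inV) => x.
rewrite -(raddf0 \pi_(Quotient.quot inV)); split=> [/eqP|Vx].
  by rewrite -Quotient.idealrBE subr0 => /asboolP.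
by apply/eqP; rewrite -Quotient.idealrBE subr0; exact/asboolP.
Qed.

End SubgroupQuotient.

(** * Finite sums of families with values in a discrete group *)

Section Evaluation.
Variables (R : crlRingType) (P : choiceType) (E : zmodType).

(* [E] carries the discrete topology. *)
Definition equicontinuous_family (b : P -> R -> E) : Prop :=
  (forall p, zmod_morphism (b p)) /\
  exists2 U, open_right_ideal U & forall p a, U a -> b p a = 0.

Lemma equicontinuous_fset (X : choiceType) (r : X -> R) (U : set R) :
  converges_to_zero r -> open_right_ideal U ->
  exists J : {fset X}, forall x, x \notin J -> U (r x).
Proof.
move=> r0 [oU [sU _]]; have fU := r0 _ (conj oU sU).
exists (fset_set [set x | ~ U (r x)]) => x; rewrite in_fset_set // => /negP xJ.
by apply: contrapT => Ux; apply: xJ; rewrite inE.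
Qed.

(** As [c] kills [U], it is continuous into the discrete group [E], and the tail outside [J] lies in
    [U]. The set [J] is a parameter so that one choice can serve all members of a family. *)
Lemma additive_tsum (c : R -> E) (U : set R) (X : choiceType) (r : X -> R)
    (J : {fset X}) :
  zmod_morphism c -> open_right_ideal U -> (forall a, U a -> c a = 0) ->
  converges_to_zero r -> (forall x, x \notin J -> U (r x)) ->
  c (tsum r) = \sum_(x <- J) c (r x).
Proof.
move=> cB [oU [sU _]] cU r0 rJ.
pose h := GRing.isZmodMorphism.Build _ _ c cB.
pose c' : {additive R -> E} := HB.pack c h.
rewrite -[RHS](raddf_sum c') -partial_sumE; apply/eqP.
rewrite -subr_eq0 -(raddfB c') /=; apply/eqP/cU.
have JJ : \forall K \near totally, (J `<=` K)%fset by exists J.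
have [K [KU JK]] := filter_ex (filterI (tsum_is r0 (conj oU sU)) JJ).
rewrite -(subrKA (partial_sum r K)); apply: subgroupD => //.
  by rewrite -opprB; exact: subgroupN.
exact: partial_sumB.
Qed.


Variables (b : P -> R -> E).
Hypothesis bC : equicontinuous_family b.

Lemma equicontinuous0 p : b p 0 = 0.
Proof. by have [bB _] := bC; have := bB p 0 0; rewrite !subrr. Qed.

Lemma equicontinuous_mul (a : R) :
  equicontinuous_family (fun p x => b p (a * x)).
Proof.
have [bB [U oU bU]] := bC; split=> [p x y /=|]; first by rewrite mulrBr bB.
have [V oV VU] := open_subgroup_mull a (conj oU.1 oU.2.1).
have /right_linearP [I oI IV] : nbhs 0 V.
  by apply: open_nbhs_nbhs; split; [exact: oV.1|exact: oV.2.1].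
by exists I => // p x /IV /VU /bU.
Qed.

(** A sum over [[set: P]] takes the default value 0 when its support is infinite, so additivity
    rests on a finite set outside which both families vanish. *)
Lemma equicontinuous_sum_split (r : combs R P) (c : P -> R -> E) :
  equicontinuous_family c ->
  \sum_(p \in [set: P]) (b p (r p) - c p (r p)) =
  \sum_(p \in [set: P]) b p (r p) - \sum_(p \in [set: P]) c p (r p).
Proof.
move=> [cB [V oV cV]]; have [bB [U oU bU]] := bC.
have [J JU] := equicontinuous_fset (coef_cvg0 r) oU.
have [K KV] := equicontinuous_fset (coef_cvg0 r) oV.
rewrite !(fsbigTE (J `|` K)%fset) ?sumrB // => p;
  rewrite inE negb_or => /andP[/JU Up /KV Vp]; rewrite ?bU ?cV ?subr0 //.
Qed.

(** Each [b p] commutes with the infinite sum over a fibre of [g], so both sides come from one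
    finite double sum. *)
Lemma sum_combs_map (Y : choiceType) (g : Y -> P) (r : combs R Y) :
  \sum_(p \in [set: P]) b p (combs_map g r p) =
  \sum_(y \in [set: Y]) b (g y) (r y).
Proof.
have [bB [U oU bU]] := bC.
have [J JU] := equicontinuous_fset (coef_cvg0 r) oU.
have E1 p : b p (combs_map g r p) =
    \sum_(y <- J) if g y == p then b p (r y) else 0.
  rewrite /= (additive_tsum (bB p) oU (bU p)
    (cvg0_if (fun y => g y == p) (coef_cvg0 r)) (J := J)).
    by apply: eq_bigr => y _; case: ifP => // _; exact: equicontinuous0.
  by move=> y /JU Uy; case: ifP => // _; exact: oU.2.1.1.
rewrite (fsbigTE [fset g y | y in J]%fset); last first.
  move=> p pJ; rewrite E1 big_seq big1 // => y yJ; case: eqP => // gy.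
  by move: pJ; rewrite -gy in_imfset.
rewrite (fsbigTE J) => [|y /JU]; last exact: bU.
under eq_bigr do rewrite E1.
rewrite exchange_big /= [LHS]big_seq [RHS]big_seq; apply: eq_bigr => y yJ.
rewrite (big_fsetD1 (g y)) /=; last by rewrite in_imfset.
rewrite eqxx big1_seq ?addr0 // => p /andP[_].
by rewrite !inE eq_sym => /andP[/negbTE ->].
Qed.

(** Since [U] is a right ideal, [r s] in [U] forces [r s * s p] in [U] for every [p]; hence one
    finite set of indices [s] serves all [p] at once. *)
Lemma sum_combs_mul (r : combs R (combs R P)) :
  \sum_(p \in [set: P]) b p (combs_mul r p) =
  \sum_(s \in [set: combs R P]) \sum_(p \in [set: P]) b p (r s * s p).
Proof.
have [bB [U oU bU]] := bC.
have [J JU] := equicontinuous_fset (coef_cvg0 r) oU.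
have [K0 KU0] := equicontinuous_fset (coef_cvg0 (combs_mul r)) oU.
have mU (s : combs R P) : exists K : {fset P},
    forall p, p \notin K -> b p (r s * s p) = 0.
  have [_ [V oV bV]] := equicontinuous_mul (r s).
  have [K KV] := equicontinuous_fset (coef_cvg0 s) oV.
  by exists K => p /KV /(bV p).
have [K KU] := choice mU.
(* [L] supports the outer sum over [p] as well as each inner sum with [s] in [J], so both orders of
   summation range over [J] and [L]. *)
pose L := (K0 `|` \bigcup_(s <- J) K s)%fset.
have E1 p : b p (combs_mul r p) = \sum_(s <- J) b p (r s * s p).
  rewrite /= (additive_tsum (bB p) oU (bU p)
    (cvg0_mulr (fun s : combs R P => s p) (coef_cvg0 r)) (J := J)) //.
  by move=> s /JU; exact: oU.2.2.
rewrite (fsbigTE L) => [|p]; last first.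
  by rewrite inE negb_or => /andP[/KU0 /(bU p)].
rewrite (fsbigTE J) => [|s /JU Us]; last first.
  by apply: fsbig1 => p _; apply: bU; exact: oU.2.2.
under eq_bigr do rewrite E1.
rewrite exchange_big /= [LHS]big_seq [RHS]big_seq; apply: eq_bigr => s sJ.
rewrite [RHS](fsbigTE L) // => p; rewrite inE negb_or => /andP[_ pL].
apply: KU; apply: contra pL => pK.
by apply/bigfcupP; exists s => //; rewrite sJ.
Qed.

End Evaluation.

(** * Contramodule laws from separating evaluations *)

Section ContramoduleLaws.
Variables (R : crlRingType) (P : choiceType) (act : combs R P -> P).

(* Since [E] is discrete, the sum is finite: the contramodule laws reduce to
   identities between finite sums as soon as such maps separate points. *)
Definition evaluates_action (E : zmodType) (b : P -> R -> E) : Prop :=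
  equicontinuous_family b /\
  forall s a, b (act s) a = \sum_(p \in [set: P]) b p (a * s p).

Hypothesis evaluations_separate : forall p q,
  (forall (E : zmodType) (b : P -> R -> E), evaluates_action b ->
    b p 1 = b q 1) -> p = q.

Lemma act_unit p : act (combs_unit R p) = p.
Proof.
apply: evaluations_separate => E b [bC ->].
rewrite (fsbigTE [fset p]%fset) => [|q]; last first.
  by rewrite inE eq_sym /= => /negbTE ->; rewrite mulr0 equicontinuous0.
by rewrite big_seq_fset1 /= eqxx mulr1.
Qed.

(** Any evaluation at 1 turns both sides into the iterated sum of [b p (r s * s p)], over [p] and
    then over [s]. *)
Lemma act_mul (r : combs R (combs R P)) :
  act (combs_map act r) = act (combs_mul r).
Proof.
apply: evaluations_separate => E b [bC bA]; rewrite !bA.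
under eq_fsbigr do rewrite mul1r; under [RHS]eq_fsbigr do rewrite mul1r.
rewrite sum_combs_map // sum_combs_mul //.
by apply: eq_fsbigr => s _; exact: bA.
Qed.

End ContramoduleLaws.

Lemma sum_lincomb (R : crlRingType) (P : choiceType) (E : zmodType)
    (b : P -> R -> E) (s : seq (R * P)) : equicontinuous_family b ->
  \sum_(p \in [set: P]) b p (lincomb s p) = \sum_(i <- s) b i.2 i.1.
Proof.
move=> bC; have [bB _] := bC.
have bS p : b p (lincomb s p) = \sum_(i <- s) if i.2 == p then b p i.1 else 0.
  pose h := GRing.isZmodMorphism.Build _ _ (b p) (bB p).
  pose c : {additive R -> E} := HB.pack (b p) h.
  rewrite -[LHS]/(c _) raddf_sum; apply: eq_bigr => i _.
  by case: ifP => // _; rewrite raddf0.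
rewrite (fsbigTE [fset p in map snd s]%fset) => [|p]; last first.
  rewrite !inE /= bS big_seq => ps; rewrite big1 // => i si; case: eqP => // ip.
  by move: ps; rewrite -ip map_f.
under eq_bigr do rewrite bS.
rewrite exchange_big /= [LHS]big_seq [RHS]big_seq; apply: eq_bigr => i si.
rewrite (big_fsetD1 i.2) /=; last by rewrite !inE map_f.
rewrite eqxx big1_seq ?addr0 // => p /andP[_].
by rewrite !inE eq_sym => /andP[/negbTE ->].
Qed.

(** * The free contramodule R[[X]] *)

Section FreeContramodule.
Variables (R : crlRingType) (X : choiceType).

(** Vanishing is uniform in [p] because right multiplication by the coefficient [p x] keeps [a] in
    the right ideal [U]. *)
Lemma coordinate_evaluation (x : X) (E : zmodType) (q : {additive R -> E}) U :
  open_right_ideal U -> (forall a, U a -> q a = 0) ->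
  evaluates_action (@combs_mul R X) (fun p a => q (a * p x)).
Proof.
move=> oU qU.
(* The single map [q] is viewed as a family over [unit], so that [equicontinuous_mul] applies to
   it. *)
have qC : equicontinuous_family (fun (_ : unit) a => q a).
  by split; [move=> _; exact: raddfB | exists U].
split.
  split=> [p a b /=|]; first by rewrite mulrBl raddfB.
  by exists U => // p a Ua; apply: qU; exact: oU.2.2.
move=> s a; have [qB [V oV qV]] := equicontinuous_mul qC a.
have [J JV] := equicontinuous_fset
  (cvg0_mulr (fun p : combs R X => p x) (coef_cvg0 s)) oV.
rewrite /= (additive_tsum (qB tt) oV (qV tt)
  (cvg0_mulr (fun p : combs R X => p x) (coef_cvg0 s)) JV).
rewrite (fsbigTE J) => [|p pJ]; last by rewrite -mulrA (qV tt) //; exact: JV.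
by apply: eq_bigr => p _; rewrite mulrA.
Qed.

(** In each coordinate take for [c] the projections of [R] onto R / U with [U] arbitrarily small,
    and use that [R] is separated. *)
Lemma combs_separated (p q : combs R X) :
  (forall x (E : zmodType) (c : {additive R -> E}) U, open_right_ideal U ->
    (forall a, U a -> c a = 0) -> c (p x) = c (q x)) -> p = q.
Proof.
move=> pq; apply: combsP => x; apply: separatedP => W oW.
have /right_linearP [U oU UW] : nbhs 0 W.
  by apply: open_nbhs_nbhs; split; [exact: oW.1|exact: oW.2.1].
have [E [c cU]] := exists_quotient oU.2.1.1 oU.2.1.2.
apply/UW/cU; rewrite raddfB; apply/eqP; rewrite subr_eq0; apply/eqP.
by apply: (pq x E c U oU) => a /cU.
Qed.

Lemma coordinates_separate (p q : combs R X) :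
  (forall (E : zmodType) (b : combs R X -> R -> E),
    evaluates_action (@combs_mul R X) b -> b p 1 = b q 1) -> p = q.
Proof.
move=> pq; apply: combs_separated => x E c U oU cU.
by have := pq _ _ (coordinate_evaluation x oU cU); rewrite !mul1r.
Qed.

HB.instance Definition _ := isContramodule.Build R (combs R X)
  (act_unit coordinates_separate) (act_mul coordinates_separate).

Lemma free_linE (s : seq (R * combs R X)) (x : X) :
  (contra_lin s : combs R X) x = \sum_(i <- s) i.1 * i.2 x.
Proof.
rewrite /contra_lin /contra_act /=.
rewrite -(tsum_delta s snd (fun i (t : combs R X) => i.1 * t x)).
congr tsum; apply/funext => t; rewrite mulr_suml.
by apply: eq_bigr => i _ /=; case: ifP => // _; rewrite mul0r.
Qed.

(** A unit law of the monad: every element of R[[X]] is an infinite combination of the generators,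
    so contramodule morphisms out of R[[X]] are determined on [X]. *)
Lemma combs_mul_map_unit (p : combs R X) :
  combs_mul (combs_map (@combs_unit R X) p) = p.
Proof.
apply: combs_separated => x E c U oU cU.
have [bC bA] := coordinate_evaluation x oU cU.
have := bA (combs_map (@combs_unit R X) p) 1; rewrite mul1r => ->.
under eq_fsbigr do rewrite mul1r.
rewrite (sum_combs_map bC) (fsbigTE [fset x]%fset) => [|y]; last first.
  by rewrite inE /= => /negbTE ->; rewrite mulr0 raddf0.
by rewrite big_seq_fset1 /= eqxx mulr1.
Qed.

End FreeContramodule.

(* The additive maps from [R / I] to [E]. *)
Record discrete_hom (R : crlRingType) (I : set R) (oI : open_right_ideal I)
    (E : zmodType) := DiscreteHom {
  discrete_fun :> R -> E;
  discrete_funB : zmod_morphism discrete_fun;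
  discrete_fun0 : forall a, I a -> discrete_fun a = 0
}.

HB.instance Definition _ R I oI E := gen_eqMixin (@discrete_hom R I oI E).
HB.instance Definition _ R I oI E := gen_choiceMixin (@discrete_hom R I oI E).

(** * The contramodule Hom(R / I, E) *)

Section DiscreteHom.
Variables (R : crlRingType) (I : set R) (oI : open_right_ideal I).
Variable (E : zmodType).
Local Notation H := (discrete_hom oI E).

Lemma discrete_homP (p q : H) : p =1 q -> p = q.
Proof.
case: p q => [p p1 p2] [q q1 q2] /= /funext pq.
by case: q / pq q1 q2 => q1 q2; congr DiscreteHom; exact: Prop_irrelevance.
Qed.

Lemma discrete_hom_equicontinuous (a : R) :
  equicontinuous_family (fun (p : H) x => p (a * x)).
Proof.
apply: (@equicontinuous_mul _ _ _ (fun (p : H) x => p x)); split.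
  by move=> p; exact: discrete_funB.
by exists I => // p; exact: discrete_fun0.
Qed.

Lemma discrete_hom_actB (s : combs R H) :
  zmod_morphism (fun a => \sum_(p \in [set: H]) p (a * s p)).
Proof.
move=> a b.
rewrite -(equicontinuous_sum_split (discrete_hom_equicontinuous a) s
  (discrete_hom_equicontinuous b)).
by apply: eq_fsbigr => p _; rewrite mulrBl discrete_funB.
Qed.

Lemma discrete_hom_act0 (s : combs R H) a : I a ->
  \sum_(p \in [set: H]) p (a * s p) = 0.
Proof.
by move=> Ia; apply: fsbig1 => p _; apply: discrete_fun0; exact: oI.2.2.
Qed.

(** The left action dual to the right [R]-module R / I. For fixed [a] the defining sum is finite,
    because [a * s p] lies in [I] for almost all [p]. *)
Definition discrete_hom_act (s : combs R H) : H :=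
  DiscreteHom oI (discrete_hom_actB s) (discrete_hom_act0 s).

(** Every [a] in [R] gives the evaluation sending [p] and [x] to [p (a * x)], whose value at 1 is
    [p a]. *)
Lemma discrete_homs_separate (p q : H) :
  (forall (F : zmodType) (b : H -> R -> F),
    evaluates_action discrete_hom_act b -> b p 1 = b q 1) -> p = q.
Proof.
move=> pq; apply: discrete_homP => a; rewrite -[a]mulr1.
apply: (pq E (fun p x => p (a * x))); split.
  exact: discrete_hom_equicontinuous.
by move=> s x /=; apply: eq_fsbigr => r _; rewrite mulrA.
Qed.

HB.instance Definition _ := isContramodule.Build R H
  (act_unit discrete_homs_separate) (act_mul discrete_homs_separate).

Lemma discrete_hom_linE (s : seq (R * H)) a :
  (contra_lin s : H) a = \sum_(i <- s) i.2 (a * i.1).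
Proof. exact: (sum_lincomb s (discrete_hom_equicontinuous a)). Qed.

Lemma discrete_hom_act_map0 (Y : choiceType) (g : Y -> H) (r : combs R Y) a :
  (forall y, (forall b, g y b = 0) \/ r y = 0) ->
  discrete_hom_act (combs_map g r) a = 0.
Proof.
move=> gr; have hC := discrete_hom_equicontinuous a.
rewrite /= (sum_combs_map hC); apply: fsbig1 => y _.
by case: (gr y) => [gy0|->]; [exact: gy0 | exact: equicontinuous0 hC _].
Qed.

End DiscreteHom.

(** * The decomposition R[[X]] = R[X] + I R[[X]] *)

Section ZeroConvergentFamilies.
Variables (R : crlRingType) (X : choiceType) (I : set R).
Hypothesis oI : open_right_ideal I.
Local Notation F := (contra_forget (combs R X : contramodType R)).
Local Notation coefs p := (p : combs R X).

Lemma forget_free_zero x : coefs (0 : F) x = 0.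
Proof. by rewrite [LHS](free_linE [::]) big_nil. Qed.

Lemma forget_free_add (p q : F) x : coefs (p + q) x = coefs p x + coefs q x.
Proof.
rewrite [LHS](free_linE [:: (1, p); (1, q)]) !big_cons big_nil /= !mul1r.
by rewrite addr0.
Qed.

Lemma forget_free_opp (p : F) x : coefs (- p) x = - coefs p x.
Proof.
by rewrite [LHS](free_linE [:: (-1, p)]) big_seq1 /= mulN1r.
Qed.

Lemma forget_free_scale a (p : F) x : coefs (a *: p) x = a * coefs p x.
Proof. by rewrite [LHS](free_linE [:: (a, p)]) big_seq1. Qed.

(* [p] belongs to [R[X] + I R[[X]]]. *)
Definition finitely_generated_mod_finite (p : F) : Prop :=
  exists (s : seq (R * combs R X)) (J : {fset X}),
    (forall i, i \in s -> I i.1) /\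
    forall x, x \notin J -> coefs p x = \sum_(i <- s) i.1 * i.2 x.

Lemma finitely_generated0 : finitely_generated_mod_finite 0.
Proof.
by exists [::], fset0; split => // x _; rewrite forget_free_zero big_nil.
Qed.

Lemma finitely_generatedB p q : finitely_generated_mod_finite p ->
  finitely_generated_mod_finite q -> finitely_generated_mod_finite (p - q).
Proof.
move=> [s [J [sI sE]]] [t [K [tI tE]]].
exists (s ++ [seq (- i.1, i.2) | i <- t]), (J `|` K)%fset; split.
  move=> i; rewrite mem_cat => /orP[/sI //|/mapP[j /tI jI ->]] /=.
  exact: subgroupN oI.2.1 jI.
move=> x; rewrite inE negb_or => /andP[xJ xK].
rewrite forget_free_add forget_free_opp sE // tE // big_cat big_map /=.
by congr (_ + _); rewrite -sumrN; apply: eq_bigr => i _; rewrite mulNr.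
Qed.

Lemma zero_convergent_finitely_generated (a : combs R X) :
  contra_forget_fully_faithful R -> finitely_generated_mod_finite a.
Proof.
move=> ff.
have [E [q qD]] := exists_quotient finitely_generated0 finitely_generatedB.
pose G := contra_forget (discrete_hom oI E : contramodType R).
have hB (p : F) : zmod_morphism (fun b : R => q (b *: p)).
  by move=> b c; rewrite scalerBl raddfB.
have h0 (p : F) (b : R) : I b -> q (b *: p) = 0.
  move=> Ib; apply/qD; exists [:: (b, coefs p)], fset0; split.
    by move=> i; rewrite inE => /eqP ->.
  by move=> x _; rewrite forget_free_scale big_seq1.
pose h (p : F) : G := DiscreteHom oI (hB p) (h0 p).
have hD : {morph h : x y / x + y}.
  move=> x y; apply: discrete_homP => b.
  rewrite [RHS](discrete_hom_linE [:: (1, h x); (1, h y)]) /=.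
  by rewrite !big_cons big_nil /= !mulr1 addr0 scalerDr raddfD.
have hZmod : zmod_morphism h.
  by move=> x y; apply/eqP; rewrite eq_sym subr_eq -hD subrK.
have hZ : scalable h.
  move=> c x; apply: discrete_homP => b.
  by rewrite [RHS](discrete_hom_linE [:: (c, h x)]) /= big_seq1 scalerA.
pose hm1 := GRing.isZmodMorphism.Build _ _ h hZmod.
pose hm2 := GRing.isScalable.Build _ _ _ _ h hZ.
pose hl : {linear F -> G} := HB.pack h hm1 hm2.
(* Fullness: the [R]-linear map [h] underlies a contramodule morphism [g hl], hence commutes with
   infinite combinations. *)
have [g _ gK] := ff (combs R X) (discrete_hom oI E).
have /= kE := congr1 (fun k : {linear F -> G} => (k : F -> G)) (gK hl).
have {}kE : (g hl : combs R X -> discrete_hom oI E) = h := kE.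
have hunit x (b : R) : h (combs_unit R x) b = 0.
  apply/qD; exists [::], [fset x]%fset; split=> // y.
  rewrite inE forget_free_scale big_nil /= eq_sym => /negbTE ->.
  by rewrite mulr0.
(* [w] is [a] rewritten as an infinite combination of the generators. *)
pose w := combs_map (@combs_unit R X) a.
have ha : h (combs_mul w) = discrete_hom_act (combs_map h w).
  by rewrite -[in LHS]kE -[in RHS]kE; exact: contra_funP.
rewrite combs_mul_map_unit in ha.
have q0 : h a 1 = 0.
  rewrite ha; apply: discrete_hom_act_map0 => y.
  (* On a generator [h] vanishes; any other element has coefficient 0 in [w], as a sum over an empty
     fibre. *)
  have [[x ->]|ny] := pselect (exists x, y = combs_unit R x); first by left.
  right; rewrite /= (@tsum_fin _ _ _ fset0) => [|x _]; last first.
    by case: eqP => // xy; case: ny; exists x.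
  by rewrite big_seq_fset0.
by apply/qD; rewrite -(scale1r (a : F)); exact: q0.
Qed.

End ZeroConvergentFamilies.

(** * Arithmetic of convergent series *)

Section InfiniteSums.
Variables (S : crlRingType) (X : choiceType).
Implicit Types (r q : X -> S) (s t : S).

Lemma open_right_ideal_subgroup (I : set S) :
  open_right_ideal I -> open_subgroup I.
Proof. by case=> oI [sI _]. Qed.

Lemma open_subgroup_right_ideal (U : set S) :
  open_subgroup U -> exists2 I, open_right_ideal I & I `<=` U.
Proof.
move=> oU; apply: right_linearP.
by apply: open_nbhs_nbhs; split; [exact: oU.1|exact: oU.2.1].
Qed.

Lemma is_tsum_mull a r s : is_tsum r s -> is_tsum (fun x => a * r x) (a * s).
Proof.
move=> rs U oU; have [V oV VU] := open_subgroup_mull a oU.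
apply: filterS (rs V oV) => J /VU.
by rewrite mulrBr !partial_sumE mulr_sumr.
Qed.

Lemma is_tsumD r q s t :
  is_tsum r s -> is_tsum q t -> is_tsum (fun x => r x + q x) (s + t).
Proof.
move=> rs qt U oU; apply: filterS (filterI (rs U oU) (qt U oU)) => J [Us Ut].
rewrite !partial_sumE big_split /= -!partial_sumE opprD addrACA.
by apply: subgroupD => //; exact: oU.2.
Qed.

Lemma is_tsum_fin r (J : {fset X}) : (forall x, x \notin J -> r x = 0) ->
  is_tsum r (\sum_(x <- J) r x).
Proof.
move=> rJ U oU; exists J => // K /= JK.
rewrite -partial_sumE; apply: partial_sumB => //; first exact: oU.2.
by move=> x /rJ ->; exact: oU.2.1.
Qed.

Lemma is_tsum_sum (T : Type) (l : seq T) (F : T -> X -> S) (G : T -> S) :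
  (forall i, is_tsum (F i) (G i)) ->
  is_tsum (fun x => \sum_(i <- l) F i x) (\sum_(i <- l) G i).
Proof.
move=> FG; elim: l => [|i l IH].
  move=> U oU; apply: filterE => J; rewrite partial_sumE big_nil subr0 big1 //.
    exact: oU.2.1.
  by move=> x _; rewrite big_nil.
rewrite big_cons (_ : (fun x => _) = (fun x => F i x + \sum_(j <- l) F j x)).
  exact: is_tsumD.
by apply/funext => x; rewrite big_cons.
Qed.

End InfiniteSums.

(** * Generated right ideals, closures and decreasing bases *)

Section RightIdeals.
Variables (R S : crlRingType).

Lemma right_ideal_smallest (A : set S) :
  right_ideal (smallest (@right_ideal S) A).
Proof.
split=> [|x r Ax M MA]; last exact: MA.1.2 (Ax M MA).
split=> [M MA|x y Ax Ay M MA]; first exact: MA.1.1.1.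
exact: MA.1.1.2 (Ax M MA) (Ay M MA).
Qed.

(** Open subgroups are closed: the coset of a closure point meets [A]. *)
Lemma closure_sub_open_subgroup (A U : set S) :
  open_subgroup U -> A `<=` U -> closure A `<=` U.
Proof.
move=> oU AU x /(_ _ (nbhs_open_subgroup x oU)) [y [Ay Uyx]].
rewrite -[x](subKr y); apply: oU.2.2 => //; exact: AU.
Qed.

Lemma closure_approx (A C : set S) (x : S) : open C -> C 0 -> closure A x ->
  exists2 y, A y & C (x - y).
Proof.
move=> oC C0 Ax.
have cvx : (fun y : S => x - y) @ x --> x - x.
  apply: (@continuous_comp _ _ _ (fun y : S => (x, y)) (fun y => y.1 - y.2)).
    by apply: cvg_pair => /=; [exact: cvg_cst | exact: cvg_id].
  exact: sub_continuous.
rewrite subrr in cvx.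
have /Ax [y [Ay Cy]] := cvx _ (open_nbhs_nbhs (conj oC C0)).
by exists y.
Qed.

(** Such sums form a right ideal containing the image of [I]. Signs go into the right factor, since
    [f] is a mere function here. *)
Lemma smallest_right_ideal_image (f : R -> S) (I : set R) (y : S) :
  smallest (@right_ideal S) (f @` I) y ->
  exists2 l : seq (R * S), (forall i, i \in l -> I i.1) &
    y = \sum_(i <- l) f i.1 * i.2.
Proof.
move: y; apply: smallest_sub.
  split; first split.
  - by exists [::] => //; rewrite big_nil.
  - move=> _ _ [k kI ->] [l lI ->].
    exists (k ++ [seq (i.1, - i.2) | i <- l]).
      by move=> i; rewrite mem_cat => /orP[/kI //|/mapP[j /lI jI ->]].
    rewrite big_cat big_map -sumrN; congr (_ + _).
    by apply: eq_bigr => i _; rewrite mulrN.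
  - move=> _ r [l lI ->]; exists [seq (i.1, i.2 * r) | i <- l].
      by move=> i /mapP[j /lI jI ->].
    by rewrite big_map mulr_suml; apply: eq_bigr => i _; rewrite mulrA.
move=> _ [a Ia <-]; exists [:: (a, 1)]; last by rewrite big_seq1 mulr1.
by move=> i; rewrite inE => /eqP ->.
Qed.

Lemma open_right_idealI (I J : set R) :
  open_right_ideal I -> open_right_ideal J -> open_right_ideal (I `&` J).
Proof.
move=> [oI [[I0 IB] IM]] [oJ [[J0 JB] JM]]; split; first exact: openI.
split=> [|x r [/IM Ix /JM Jx]]; last by split.
by split=> // x y [Ix Jx] [Iy Jy]; split; [exact: IB | exact: JB].
Qed.

(** Number the basic neighborhoods by an injection [e] into the naturals, choose an open right ideal
    [J n] inside the one numbered [n] (or [I] if there is none), and intersect [I] with [J 0], ...,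
    [J n]. *)
Lemma open_right_ideal_base (I : set R) :
  countable_base_at_zero R -> open_right_ideal I ->
  exists K : nat -> set R, [/\ forall n, open_right_ideal (K n),
    forall n, K n `<=` I &
    forall V, nbhs 0 V -> exists n, forall m, (n <= m)%N -> K m `<=` V].
Proof.
move=> [B /pcard_injP[e einj] nB] oI.
have exJ n : exists J, open_right_ideal J /\
    forall W, B W -> e W = n -> J `<=` W.
  have [[W [BW eW]]|nW] := pselect (exists W, B W /\ e W = n).
    have /right_linearP [J oJ JW] : nbhs (0 : R) W by rewrite nB; exists W.
    exists J; split=> // W' BW' eW'.
    by rewrite (_ : W' = W) //; apply: einj; rewrite ?inE // eW'.
  by exists I; split=> // W BW eW; case: nW; exists W.
have [J JP] := choice exJ.
pose K := fix K n := if n is m.+1 then K m `&` J n else I `&` J 0%N.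
have KS m n : (n <= m)%N -> K m `<=` K n.
  elim: m => [|m IH]; first by rewrite leqn0 => /eqP ->.
  by rewrite leq_eqVlt => /predU1P[-> //|/IH Kn x [/Kn]].
exists K; split=> [n|n|V].
- elim: n => [|n IH]; apply: open_right_idealI => //; exact: (JP _).1.
- by move=> x /(KS _ _ (leq0n n)) [].
- rewrite nB => -[W BW WV]; exists (e W) => m /KS Km x /Km Kx.
  apply: WV; apply: (JP (e W)).2 BW erefl _ _.
  by case: (e W) Kx => [|n] [].
Qed.

End RightIdeals.

(** * Taut maps: replacing the closure of f(J) S by f(I) S *)

Section Taut.
Variables (R S : crlRingType) (f : {rmorphism R -> S}).
Hypothesis f_cont : continuous f.

Lemma open_right_ideal_preimage (V : set S) :
  open_right_ideal V -> open_right_ideal (f @^-1` V).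
Proof.
move=> [oV [[V0 VB] VM]]; split.
  by apply: open_comp => // x _; exact: f_cont.
split=> [|x r /= Vx]; last by rewrite rmorphM; exact: VM.
by split=> [|x y /= Vx Vy]; [rewrite /= rmorph0 | rewrite rmorphB; exact: VB].
Qed.

Lemma converges_to_zero_image (X : Type) (r : X -> R) :
  converges_to_zero r -> converges_to_zero (f \o r).
Proof.
move=> r0 U oU; have [V oV VU] := open_subgroup_right_ideal oU.
have := r0 _ (open_right_ideal_subgroup (open_right_ideal_preimage oV)).
by apply: sub_finite_set => x /=; apply: contra_not => /VU.
Qed.

Lemma closure_image_sub_generated (I : set R) :
  contra_forget_fully_faithful R -> countable_base_at_zero R -> taut f ->
  open_right_ideal I -> exists2 J, open_right_ideal J &
    closure (smallest (@right_ideal S) (f @` J)) `<=`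
    smallest (@right_ideal S) (f @` I).
Proof.
move=> ff cR ft oI; have [K [oK KI K0]] := open_right_ideal_base cR oI.
exists (K 0%N); first exact: oK.
pose C n := closure (smallest (@right_ideal S) (f @` K n)).
have C0 n : C n 0.
  by apply: subset_closure; exact: (right_ideal_smallest _).1.1.
(* The condition on [y] sits inside the existential so that [choice] yields a total function;
   outside [C n] the list is a dummy. *)
have step n y : exists l : seq (R * S), C n y ->
    (forall i, i \in l -> K n i.1) /\
    C n.+1 (y - \sum_(i <- l) f i.1 * i.2).
  have [Cy|nC] := pselect (C n y); last by exists [::].
  have [z /smallest_right_ideal_image [l lK zE] Cz] :=
    closure_approx (ft _ (oK n.+1)) (C0 n.+1) Cy.
  by exists l => _; rewrite -zE.
have [L LP] := choice (fun u : nat * S => step u.1 u.2).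
move=> y Cy.
(* [rest n] is the remainder of [y] after [n] successive approximations, the next one using the
   terms [l n]. *)
pose rest := fix rest n := if n is m.+1
  then rest m - \sum_(i <- L (m, rest m)) f i.1 * i.2 else y.
pose l n := L (n, rest n).
have Crest n : C n (rest n).
  by elim: n => [//|n IH]; exact: (LP (n, rest n) IH).2.
have lK n i : i \in l n -> K n i.1 by exact: (LP (n, rest n) (Crest n)).1.
have yE n : y = rest n + \sum_(k < n) \sum_(i <- l k) f i.1 * i.2.
  elim: n => [|n IH]; first by rewrite big_ord0 addr0.
  by rewrite big_ord_recr /= -/(l n) addrACA addNr addr0.
(* The lists [l k] are flattened into one family indexed by pairs (k, i), padded with zeros beyond
   the length of [l k]. *)
pose a (x : nat * nat) := (nth (0, 0) (l x.1) x.2).1.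
pose t (x : nat * nat) := (nth (0, 0) (l x.1) x.2).2.
have aK x : K x.1 (a x).
  rewrite /a; case: (ltnP x.2 (size (l x.1))) => xl.
    by apply: lK; exact: mem_nth.
  by rewrite nth_default //; exact: (oK _).2.1.1.
have aout x : (size (l x.1) <= x.2)%N -> a x = 0.
  by move=> xl; rewrite /a nth_default.
pose Tseq n := [seq (k, i) | k <- iota 0 n, i <- iota 0 (size (l k))].
pose T n : {fset nat * nat} := [fset x in Tseq n]%fset.
have inT n x : (x \in T n) = (x.1 < n)%N && (x.2 < size (l x.1))%N.
  case: x => k i; rewrite inE /=; apply/allpairsPdep/andP => /=.
    by move=> [k' [i' []]]; rewrite !mem_iota /= => ? ? [-> ->].
  by move=> [kn il]; exists k, i; rewrite !mem_iota.
have aT V : nbhs 0 V ->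
    exists n, forall m, (n <= m)%N -> forall x, x \notin T m -> V (a x).
  move=> V0; have [n nV] := K0 V V0; exists n => m nm x.
  rewrite inT negb_and -!leqNgt; case: (leqP m x.1) => [mx _|_ /= /aout ->].
    by apply: nV (leq_trans nm mx) _ (aK x).
  exact: nbhs_singleton.
have a0 : converges_to_zero a.
  move=> U oU.
  have [n nT] := aT U (open_nbhs_nbhs (conj oU.1 oU.2.1)).
  apply: sub_finite_set (finite_fset (T n)) => x /= nU.
  by apply: contrapT => /negP /(nT n (leqnn n)).
have sumT n : \sum_(x <- T n) f (a x) * t x =
    \sum_(k < n) \sum_(i <- l k) f i.1 * i.2.
  rewrite (perm_big (Tseq n)) /=; last first.
    apply: uniq_perm; [exact: fset_uniq | | by move=> x; rewrite inE].
    apply: allpairs_uniq_dep => [|k _|]; try exact: iota_uniq.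
    by move=> [k i] [k' i'] _ _ [-> ->].
  have iotaE m : iota 0 m = index_iota 0 m by rewrite /index_iota subn0.
  rewrite big_allpairs_dep iotaE big_mkord; apply: eq_bigr => k _.
  by rewrite (big_nth (0, 0)) iotaE.
have yS : is_tsum (fun x => f (a x) * t x) y.
  move=> U oU; have [V oV VU] := open_subgroup_right_ideal oU.
  have oV' := open_right_ideal_preimage oV.
  have nV' := open_nbhs_nbhs (conj oV'.1 oV'.2.1.1).
  have [n nV] := aT _ nV'; have [m mV] := K0 _ nV'.
  (* [n] controls the terms outside [T N], and [m] the remainder [rest N], which lies in the closed
     set [V] because f(K N) does. *)
  pose N := maxn n m; exists (T N) => // J /= TJ; apply: VU.
  rewrite -(subrKA (partial_sum (fun x => f (a x) * t x) (T N))).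
  apply: subgroupD; first exact: oV.2.1.
    apply: partial_sumB => //; first exact: oV.2.1.
    by move=> x /(nV _ (leq_maxl n m)); exact: oV.2.2.
  rewrite partial_sumE sumT [in X in V X](yE N) opprD addrCA subrr addr0.
  apply: subgroupN; first exact: oV.2.1.
  apply: (closure_sub_open_subgroup (open_right_ideal_subgroup oV)) (Crest N).
  apply: smallest_sub; first exact: oV.2.
  by move=> _ [b Kb <-]; exact: mV (leq_maxr n m) _ Kb.
have [s [F [sI sE]]] := zero_convergent_finitely_generated oI (Combs a0) ff.
set G := smallest _ _.
have GG : right_ideal G := right_ideal_smallest _.
have fG b u : I b -> G (f b * u).
  by move=> Ib; apply: GG.2; apply: sub_gen_smallest; exists b.
(* Each inner series converges, since right multiplication by [t x] preserves convergence to zero in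
   the right linear ring [S]. *)
have sumG : is_tsum (fun x => \sum_(i <- s) f i.1 * (f (i.2 x) * t x))
    (\sum_(i <- s) f i.1 * tsum (fun x => f (i.2 x) * t x)).
  apply: is_tsum_sum => i; apply: is_tsum_mull; apply: tsum_is.
  exact: (cvg0_mulr t (converges_to_zero_image (coef_cvg0 i.2))).
(* The discrepancy between the two series is supported on the finite set [F]; subtracting it leaves
   a finite combination of elements of f(I). *)
pose d x := f (a x) * t x - \sum_(i <- s) f i.1 * (f (i.2 x) * t x).
have d0 x : x \notin F -> d x = 0.
  move=> /sE /= ax; rewrite /d ax rmorph_sum mulr_suml -sumrB big1 // => i _.
  by rewrite rmorphM mulrA subrr.
have := is_tsumD (is_tsum_fin d0) sumG.
under [X in is_tsum X]eq_fun do rewrite /d subrK.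
move=> /(is_tsum_unique yS) ->.
have sumGG : forall g : combs R (nat * nat)%type -> S,
    G (\sum_(i <- s) f i.1 * g i.2).
  move=> g; rewrite big_seq; apply: (@subgroup_sum _ G) => [|i /sI].
    exact: GG.1.
  exact: fG.
apply: (@subgroupD _ G) => //; first exact: GG.1; last first.
  exact: (sumGG (fun p => tsum (fun x => f (p x) * t x))).
apply: (@subgroup_sum _ G) => [|x _]; first exact: GG.1.
apply: GG.1.2; first by apply: fG; apply: KI (aK x).
exact: (sumGG (fun p => f (p x) * t x)).
Qed.

End Taut.


(** * Annihilators and discrete modules *)

Lemma right_ideal_annihilator (R : topRingType) (N : lmodType R^c) (n : N) :
  right_ideal [set r : R | (r : R^c) *: n = 0].
Proof.
split=> [|x r /= xn]; last first.
  by rewrite -[x * r]/((r : R^c) * (x : R^c)) -scalerA xn scaler0.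
split=> [|x y /= xn yn]; first exact: scale0r.
by rewrite (scalerBl (x : R^c) y n) xn yn subr0.
Qed.

(** With each of its points, [J] contains a whole coset of [I]. *)
Lemma open_right_ideal_super (R : crlRingType) (I J : set R) :
  open_right_ideal I -> right_ideal J -> I `<=` J -> open_right_ideal J.
Proof.
move=> oI rJ IJ; split=> //; rewrite openE => x Jx.
have := nbhs_open_subgroup x (open_right_ideal_subgroup oI).
apply: filterS => y /IJ Jyx; rewrite -(subrK x y).
exact: subgroupD rJ.1 Jyx Jx.
Qed.

Theorem proposition9p1 (R S : crlRingType)
  (hR : countable_base_at_zero R) (hS : countable_base_at_zero S)
  (f : {rmorphism R -> S}) (f_cont : continuous f) (f_taut : taut f)
  (ff : contra_forget_fully_faithful R) (N : lmodType S^c) :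
  discrete_right_module N <-> discrete_right_module (restrict_scalars f N).
Proof.
split=> [dN n|dN n].
  (* The annihilator of [n] in [R] is the preimage under [f] of its annihilator in [S]. *)
  exact: (open_right_ideal_preimage f_cont (dN n)).
have [J oJ JI] := closure_image_sub_generated f_cont ff hR f_taut (dN n).
have rN := right_ideal_annihilator (n : N).
split; last exact: rN.
have oC := f_taut _ oJ.
have /right_linearP [K oK KC] :
    nbhs 0 (closure (smallest (@right_ideal S) [set f x | x in J])).
  apply: open_nbhs_nbhs; split=> //.
  by apply: subset_closure; exact: (right_ideal_smallest _).1.1.
(* [K] lies in the closure of f(J) S, hence in the right ideal generated by the image of the
   annihilator of [n] in [R], which kills [n]. *)
apply: (open_right_ideal_super oK rN _).1 => x /KC /JI; move: x.
by apply: smallest_sub => // _ [r rn <-].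
Qed.
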